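(* Let $P\ge 1$, $M\ge 1$ and $1\le L\le M$ be integers. In the continue-on-completion cooperative coupon game with $P$ players, $M$ labels and lots of $L$ coupons, the average number of offered coupons is $$\mathcal{C}^{\rm off}=\mathcal{B}^{\mathbf{goal}}\,L-\frac{M}{2}(P+1),$$ where $\mathcal{B}^{\mathbf{goal}}$ is the average number of bursts needed to reach the common goal.
   Context: The game. $P$ players collect coupons, each carrying one of $M$ labels; initially nobody has a coupon. Each player's local goal is to own one coupon of every label; the common goal is that all players reach their local goal. The game proceeds in bursts. In each burst a lot of $L$ coupons with pairwise different labels enters the system. Lots are drawn independently of each other and of all other random choices, from a common probability distribution on the $L$-element subsets of the label set such that every label has positive probability of belonging to a lot. The whole lot is assigned to one player, selected independently each time and uniformly among all $P$ players. That player retains the coupons of the lot whose labels she misses and offers every other (duplicate) coupon of the lot to the other players (a coupon is offered whether or not some other player needs it). Each player missing the label of an offered coupon issues one request for it. If there is at least one request, the coupon is assigned uniformly at random (independently for different coupons) to one of the requesting players and transferred to her; if there is no request it is discarded. In the continue-on-completion game all $P$ players remain active until the common goal is reached, even if they have completed their own collections. No new burst is started once the common goal has been achieved. $\mathcal{C}^{\rm off}$ is the expected total number of offered coupons over the whole game until the common goal is reached. $\mathcal{B}^{\mathbf{goal}}$ is the expected number of bursts until the common goal is reached. *)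

(* Defs.v *)
From mathcomp Require Import all_boot all_order all_algebra.
From mathcomp Require Import all_classical all_reals all_analysis.

Set Implicit Arguments.
Unset Strict Implicit.
Unset Printing Implicit Defensive.

Import Order.TTheory GRing.Theory Num.Theory.

Local Open Scope ring_scope.

(* Players are 'I_P and labels are 'I_M; a collection records the set of labels
   owned by each player. *)
Definition collections (P M : nat) : finType := {ffun 'I_P -> {set 'I_M}}.

(* The outcome (A, p, t) of a burst: the lot A, the player p it is assigned to,
   and, for each label l, the player t l to whom the offered coupon l is
   transferred; t l = None if l is not offered or if it is discarded. *)
Definition burst (P M : nat) : finType :=
  ({set 'I_M} * 'I_P * {ffun 'I_M -> option 'I_P})%type.

Section Rules.
Variables P M : nat.
Implicit Types (S : collections P M) (b : burst P M) (h : seq (burst P M)).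

Definition lot b : {set 'I_M} := b.1.1.
Definition recipient b : 'I_P := b.1.2.
Definition transfer b : {ffun 'I_M -> option 'I_P} := b.2.

Definition empty_collections : collections P M := [ffun=> finset.set0].

Definition offered S b : {set 'I_M} := lot b :&: S (recipient b).

Definition requesting S (l : 'I_M) : {set 'I_P} := [set p | l \notin S p].

Definition after_burst S b : collections P M :=
  [ffun p => S p :|: (if p == recipient b then lot b else finset.set0)
                 :|: [set l | transfer b l == Some p]].

Definition collections_after h : collections P M :=
  foldl after_burst empty_collections h.

Definition common_goal S : bool := [forall p, S p == finset.setT].

End Rules.

Section Law.
Variables (R : realType) (P M : nat).
Implicit Types (S : collections P M) (b : burst P M) (h : seq (burst P M)).

Definition lot_distribution (L : nat) (q : {set 'I_M} -> R) : Prop :=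
  [/\ forall A, 0 <= q A,
      forall A : {set 'I_M}, #|A| != L -> q A = 0,
      \sum_(A : {set 'I_M}) q A = 1
    & forall l : 'I_M, 0 < \sum_(A : {set 'I_M} | l \in A) q A].

(* Law of the fate t l of label l: a uniformly chosen requesting player if l is
   offered and requested, and None otherwise. *)
Definition transfer_prob S b (l : 'I_M) : R :=
  if (l \in offered S b) && (requesting S l != finset.set0) then
    if transfer b l is Some p then
      if p \in requesting S l then #|requesting S l|%:R^-1 else 0
    else 0
  else (transfer b l == None)%:R.

Definition burst_prob (q : {set 'I_M} -> R) S b : R :=
  q (lot b) * P%:R^-1 * \prod_(l : 'I_M) transfer_prob S b l.

Variables (d : measure_display) (T : measurableType d) (Pr : probability T R).
Variable X : nat -> T -> burst P M.

Definition play (w : T) (n : nat) : seq (burst P M) := mkseq (X^~ w) n.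

(* X n is the burst number n (counted from 0).  Its conditional law is
   prescribed after every possible past of a game that is still running; the
   product form of burst_prob makes the lot and the recipient independent of
   each other and of the past, and the transfers of different coupons
   conditionally independent.  The X n following the common goal are
   unconstrained and are never counted below. *)
Definition coupon_game (q : {set 'I_M} -> R) : Prop :=
  (forall n b, measurable [set w | X n w = b]%classic) /\
  (forall h b, ~~ common_goal (collections_after h) ->
     (Pr [set w | play w (size h).+1 = rcons h b]%classic
      = Pr [set w | play w (size h) = h]%classic
        * (burst_prob q (collections_after h) b)%:E)%E).

Definition goal_after (w : T) (n : nat) : bool :=
  common_goal (collections_after (play w n)).

(* Number of bursts until the common goal is reached, +oo if it never is. *)
Definition goal_time (w : T) : \bar R :=
  ereal_inf [set n%:R%:E | n in [set n | goal_after w n]]%classic.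

Definition num_offered (w : T) : \bar R :=
  (\sum_(0 <= n <oo | ~~ goal_after w n)
     #|offered (collections_after (play w n)) (X n w)|%:R%:E)%E.

Definition Bgoal : \bar R := (\int[Pr]_w goal_time w)%E.

Definition Coff : \bar R := (\int[Pr]_w num_offered w)%E.

End Law.

(* Main.v *)
Require Import Defs.
From mathcomp Require Import all_boot all_order all_algebra.
From mathcomp Require Import all_classical all_reals all_analysis.
From mathcomp Require Import measurable_realfun.
From mathcomp Require Import ring.

Set Implicit Arguments.
Unset Strict Implicit.
Unset Printing Implicit Defensive.

Import Order.TTheory GRing.Theory Num.Theory.
Import numFieldNormedType.Exports.

Local Open Scope ring_scope.

(* For a label l, let r_l be the number of players missing l.  When l belongs to
   the lot of a burst, the recipient misses it with probability r_l / P: then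
   the coupon is not offered, and in all cases r_l drops by one unless it is
   already 0.  Hence the potential [\sum_l r_l (r_l + 1) / (2 P)] decreases in
   mean, at each burst of a running game, by exactly the mean number of coupons
   of the lot that are not offered (the drift).  The potential goes from
   M (P + 1) / 2 to 0, which is the mean total number of coupons that are never
   offered.  The drift is bounded away from 0 while the game is running, so the
   expected number of bursts is finite; the potential still in play at burst n
   is at most a constant times the probability that the game is running, which
   is summable and hence tends to 0. *)

Lemma sum_option (V : nmodType) (I : finType) (F : option I -> V) :
  \sum_x F x = F None + \sum_i F (Some i).
Proof.
rewrite (bigD1 None)//=; congr (_ + _).
rewrite (reindex_omap Some id)/=; last by case.
by apply: eq_bigl => i; rewrite eqxx.
Qed.

(** * One burst from a fixed state: fates of coupons, missing counts, potential *)

Section OneBurst.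
Variables (R : realType) (P M : nat).
Implicit Types (S : collections P M) (b : burst P M) (l : 'I_M).

Definition missing S l : nat := #|requesting S l|.

(** [transfer_prob] reads a transfer function only at [l]. Feeding it a constant function makes it
    depend on the single fate [x], as the exchange of sum and product in [sum_burst_prob]
    requires. *)
Definition fate_prob S (A : {set 'I_M}) (p : 'I_P) l (x : option 'I_P) : R :=
  transfer_prob R S (A, p, [ffun=> x]) l.

Lemma transfer_probE S b l :
  transfer_prob R S b l = fate_prob S (lot b) (recipient b) l (transfer b l).
Proof.
by rewrite /fate_prob /transfer_prob /offered /lot /recipient /transfer/= ffunE.
Qed.

Lemma sum_fate_prob S A p l : \sum_x fate_prob S A p l x = 1.
Proof.
rewrite sum_option /fate_prob /transfer_prob.
under eq_bigr do rewrite /transfer/= ffunE.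
rewrite /transfer/= ffunE; case: ifPn => [/andP[_ rl0]|_]; last first.
  by rewrite big1 ?addr0.
rewrite add0r -big_mkcond/= sumr_const -[LHS]mulr_natr mulVf//.
by rewrite pnatr_eq0 cards_eq0.
Qed.

(** The transfers integrate out, leaving an independent lot and uniform recipient. *)
Lemma sum_burst_prob (q : {set 'I_M} -> R) S (F : {set 'I_M} -> 'I_P -> R) :
  \sum_b burst_prob q S b * F (lot b) (recipient b) =
  \sum_A q A * (\sum_p P%:R^-1 * F A p).
Proof.
rewrite -(pair_bigA _ (fun u t => burst_prob q S (u, t) * F u.1 u.2))/=.
rewrite -(pair_bigA _ (fun A p => \sum_t burst_prob q S (A, p, t) * F A p))/=.
apply: eq_bigr => A _; rewrite mulr_sumr; apply: eq_bigr => p _.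
rewrite -mulr_suml mulrA; congr (_ * _).
rewrite -[RHS]mulr1 /burst_prob.
under eq_bigr do (under eq_bigr do rewrite transfer_probE); rewrite /lot/=.
rewrite -mulr_sumr; congr (_ * _).
(* By distributivity, the sum over transfer functions is a product over labels of total fate
   probabilities, each equal to 1. *)
rewrite -(bigA_distr_bigA (fun l x => fate_prob S A p l x)) big1// => l _.
exact: sum_fate_prob.
Qed.

Lemma sub_after_burst S b p : S p \subset after_burst S b p.
Proof. by rewrite ffunE -finset.setUA finset.subsetUl. Qed.

Lemma common_goal_after_burst S b :
  common_goal S -> common_goal (after_burst S b).
Proof.
move=> /forallP gS; apply/forallP => p; rewrite finset.eqEsubset finset.subsetT/=.
by rewrite -(eqP (gS p)) sub_after_burst.
Qed.

Lemma in_requesting_after S b l p :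
  (p \in requesting (after_burst S b) l) =
  [&& p \in requesting S l, ~~ ((p == recipient b) && (l \in lot b))
    & transfer b l != Some p].
Proof.
rewrite !inE ffunE !inE !negb_or -andbA; congr [&& _, ~~ _ & _].
by case: eqP; rewrite ?inE.
Qed.

(** Nonzero probability forces a consistent transfer. A lot label that somebody misses is then
    gained by exactly one player: the recipient if she misses it, otherwise the chosen requester. If
    nobody misses it, truncated subtraction keeps the count at 0. *)
Lemma missing_after_burst (q : {set 'I_M} -> R) S b l :
  burst_prob q S b != 0 ->
  missing (after_burst S b) l = (missing S l - (l \in lot b))%N.
Proof.
rewrite /burst_prob mulf_eq0 negb_or => /andP[_ /prodf_neq0/(_ l isT)].
have card_loses p : p \in requesting S l ->
    requesting (after_burst S b) l = (requesting S l :\ p)%SET ->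
    missing (after_burst S b) l = (missing S l - 1)%N.
  by rewrite /missing => pl ->; rewrite (cardsD1 p (requesting S l)) pl add1n subn1.
rewrite /transfer_prob /offered inE.
have [lA|lA]/= := boolP (l \in lot b); last first.
  case: (transfer b l =P None) => [tl _|]; last by rewrite eqxx.
  rewrite subn0; congr #|pred_of_set _|; apply/setP => p.
  by rewrite in_requesting_after tl (negbTE lA) andbF andbT.
have [lS|lS]/= := boolP (l \in S (recipient b)); last first.
  case: (transfer b l =P None) => [tl _|]; last by rewrite eqxx.
  apply: (card_loses (recipient b)); first by rewrite inE.
  by apply/setP => p; rewrite in_requesting_after tl lA andbT andbT !inE andbC.
have [r0 _|rN0]/= := eqVneq (requesting S l) finset.set0.
  rewrite /missing r0 cards0 sub0n; apply/eqP; rewrite cards_eq0.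
  by apply/eqP/setP => p; rewrite in_requesting_after r0 !inE.
case tl : (transfer b l) => [p|]; last by rewrite eqxx.
case: ifPn => [pl _|]; last by rewrite eqxx.
apply: (card_loses p) => //; apply/setP => p'.
rewrite in_requesting_after tl !inE lA andbT.
have [->|_] := eqVneq p' (recipient b); first by rewrite lS /= andbF.
by rewrite /= andbC (inj_eq Some_inj) eq_sym.
Qed.

(** For a label missed by r players the summand is 1/P + 2/P + ... + r/P, so lowering r by one costs
    r/P, the chance that the recipient misses the label. *)
Definition potential S : R :=
  \sum_l (missing S l)%:R * (missing S l).+1%:R / (2 * P%:R).

Definition drift (q : {set 'I_M} -> R) S : R :=
  \sum_A q A * \sum_(l in A) (missing S l)%:R / P%:R.

Lemma potential_ge0 S : 0 <= potential S.
Proof. by apply: sumr_ge0 => l _; rewrite !mulr_ge0 ?invr_ge0 ?mulr_ge0. Qed.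

Lemma missing0P S : reflect (forall l, missing S l = 0%N) (common_goal S).
Proof.
apply: (iffP forallP) => [gS l|m0 p].
  apply/eqP; rewrite cards_eq0; apply/eqP/setP => p.
  by rewrite !inE (eqP (gS p)) inE.
apply/eqP/setP => l; move/eqP: (m0 l); rewrite cards_eq0 => /eqP/setP/(_ p).
by rewrite !inE => /negbFE ->.
Qed.

Lemma potential_goal S : common_goal S -> potential S = 0.
Proof. by move/missing0P => m0; rewrite [LHS]big1// => l _; rewrite m0 !mul0r. Qed.

Hypothesis P_gt0 : (0 < P)%N.

Let P_neq0 : P%:R != 0 :> R. Proof. by rewrite pnatr_eq0 -lt0n. Qed.

Lemma potential_empty :
  potential (empty_collections P M) = M%:R / 2 * (P%:R + 1).
Proof.
rewrite /potential (eq_bigr (fun=> (P%:R + 1) / 2)) => [|l _].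
  by rewrite sumr_const card_ord -[LHS]mulr_natl; field.
have -> : missing (empty_collections P M) l = P.
  rewrite /missing -[RHS]card_ord; apply: eq_card => p.
  by rewrite inE ffunE inE.
by rewrite -natr1; field.
Qed.

Lemma sum_const_recipient (c : R) : \sum_(p : 'I_P) P%:R^-1 * c = c.
Proof. by rewrite sumr_const card_ord -[LHS]mulr_natl mulrA divff// mul1r. Qed.

(** * Mean effect of one burst on the potential and on the offers *)

Section Expectations.
Variables (L : nat) (q : {set 'I_M} -> R).
Hypothesis hq : lot_distribution L q.

Lemma expected_potential S :
  \sum_b burst_prob q S b * potential (after_burst S b) = potential S - drift q S.
Proof.
have [_ _ q1 _] := hq.
pose pot r : R := r%:R * r.+1%:R / (2 * P%:R).
pose F (A : {set 'I_M}) : R := \sum_l pot (missing S l - (l \in A))%N.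
transitivity (\sum_b burst_prob q S b * F (lot b)).
  (* Impossible bursts carry weight 0; on the others the new counts depend on the lot alone. *)
  apply: eq_bigr => b _; have [->|bN0] := eqVneq (burst_prob q S b) 0.
    by rewrite !mul0r.
  by congr (_ * _); apply: eq_bigr => l _; rewrite (missing_after_burst _ bN0).
rewrite (sum_burst_prob q S (fun A _ => F A)) /drift.
have -> : potential S = \sum_A q A * potential S by rewrite -mulr_suml q1 mul1r.
rewrite -sumrB; apply: eq_bigr => A _.
rewrite /= sum_const_recipient -mulrBr; congr (_ * _).
rewrite [in RHS]big_mkcond -sumrB; apply: eq_bigr => l _.
case: (l \in A); last by rewrite subn0 subr0.
rewrite /pot; case: (missing S l) => [|r]; first by rewrite sub0n; ring.
by rewrite subn1/= -!natr1; field.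
Qed.

(** A label of the lot is offered when the recipient owns it, which has probability 1 - r/P if r
    players miss it; a lot has [L] labels almost surely. *)
Lemma expected_offered S :
  \sum_b burst_prob q S b * #|offered S b|%:R = L%:R - drift q S.
Proof.
have [_ qL q1 _] := hq.
rewrite (sum_burst_prob q S (fun A p => #|A :&: S p|%:R)) /drift.
have -> : L%:R = \sum_A q A * L%:R by rewrite -mulr_suml q1 mul1r.
rewrite -sumrB; apply: eq_bigr => A _.
have [cA|/qL ->] := eqVneq #|A| L; last by rewrite !mul0r subr0.
rewrite -mulrBr -cA; congr (_ * _).
transitivity (\sum_(l in A) \sum_(p : 'I_P) P%:R^-1 * (l \in S p)%:R : R).
  rewrite exchange_big/=; apply: eq_bigr => p _.
  rewrite -mulr_sumr; congr (_ * _); rewrite -natr_sum -big_mkcondr/= sum1_card.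
  by congr _%:R; apply: eq_card => l; rewrite !inE.
rewrite -sum1_card natr_sum -sumrB; apply: eq_bigr => l _.
have -> : (missing S l)%:R = P%:R - \sum_(p : 'I_P) (l \in S p)%:R :> R.
  have -> : P%:R = \sum_(p : 'I_P) 1 :> R by rewrite sumr_const card_ord.
  rewrite /missing -sum1_card natr_sum big_mkcond -sumrB; apply: eq_bigr => p _.
  by rewrite inE; case: (l \in S p); rewrite ?subr0 ?subrr.
by rewrite -mulr_sumr; field.
Qed.

(** A single label [l] still missed contributes at least 1/P times the probability that a lot
    contains [l]. Summing the inverses over all labels gives a constant that serves whichever label
    is missed. *)
Lemma drift_bound :
  exists2 K : R, 0 <= K & forall S, ~~ common_goal S -> 1 <= K * drift q S.
Proof.
have [q0 _ _ ql0] := hq.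
have drift_ge0 S : 0 <= drift q S.
  apply: sumr_ge0 => A _; rewrite mulr_ge0//; apply: sumr_ge0 => l _.
  by rewrite divr_ge0.
exists (\sum_l P%:R / \sum_(A : {set 'I_M} | l \in A) q A) => [|S].
  by apply: sumr_ge0 => l _; rewrite divr_ge0// ltW.
move=> /missing0P/existsNP[l /eqP mlN0].
rewrite (bigD1 l)//= mulrDl -[leLHS]addr0 lerD//; last first.
  by rewrite mulr_ge0// sumr_ge0// => k _; rewrite divr_ge0// ltW.
rewrite mulrAC ler_pdivlMr// mul1r /drift mulr_sumr big_mkcond/=.
apply: ler_sum => A _; case: ifPn => [lA|_].
  rewrite (bigD1 l)//= mulrCA ler_peMr// mulrDr mulrCA divff// mulr1.
  rewrite -[leLHS]addr0 lerD ?ler1n ?lt0n//.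
  by apply: mulr_ge0 => //; apply: sumr_ge0 => k _; rewrite divr_ge0.
do 2!apply: mulr_ge0 => //.
by apply: sumr_ge0 => k _; rewrite divr_ge0.
Qed.

End Expectations.
End OneBurst.

(** * Integrals of functions of a finitely valued random variable *)

Section FiniteValued.
Variables (R : realType) (d : measure_display) (T : measurableType d).
Variables (Pr : probability T R) (I : finType) (Z : T -> I).
Hypothesis mZ : forall i, measurable [set w | Z w = i]%classic.

Definition law (i : I) : R := fine (Pr [set w | Z w = i]%classic).

Lemma EFin_law i : (law i)%:E = Pr [set w | Z w = i]%classic.
Proof. by rewrite fineK// fin_num_measure. Qed.

Lemma law_ge0 i : 0 <= law i.
Proof. by rewrite fine_ge0. Qed.

Lemma measurable_preimage_fin (D : set I) : measurable [set w | D (Z w)]%classic.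
Proof.
rewrite [X in measurable X](_ : _ =
    (\bigcup_(i in D) [set w | Z w = i])%classic).
  exact: fin_bigcup_measurable.
by apply/seteqP; split=> [w DZw|w [i Di /= Zw]]; [exists (Z w)|rewrite /= Zw].
Qed.

Lemma integral_fin_valued (F : I -> R) : (forall i, 0 <= F i) ->
  (\int[Pr]_w (F (Z w))%:E = (\sum_i law i * F i)%:E)%E.
Proof.
move=> F0.
have mI i : measurable_fun setT (fun w => (\1_[set w | Z w = i]%classic w : R)%:E).
  by apply/measurable_EFinP; exact: measurable_indic.
transitivity (\int[Pr]_w
    (\sum_i (F i)%:E * (\1_[set w | Z w = i]%classic w)%:E))%E.
  apply: eq_integral => w _; rewrite (bigD1 (Z w))//= indicE mem_set// mule1.
  rewrite big1 ?adde0// => i iZ; rewrite indicE memNset ?mule0// => /= /esym/eqP.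
  by rewrite (negbTE iZ).
rewrite ge0_integral_sum//; first last.
- by move=> i w _; rewrite mule_ge0 ?lee_fin// F0.
- by move=> i; exact: measurable_funeM.
rewrite -sumEFin; apply: eq_bigr => i _.
rewrite ge0_integralZl_EFin//.
by rewrite integral_indic// setIT EFinM EFin_law muleC.
Qed.

End FiniteValued.

(** * Series of reals governed by a telescoping potential *)

Section RealSeries.
Local Open Scope classical_set_scope.

(** To be used with [rho n] the probability that the game runs after [n] bursts, [delta n] the mean
    drift and [F n] the mean potential. The second series has the mean numbers of offered coupons as
    its terms. *)
Lemma drift_series (R : realType) (rho delta F : R^nat) (K C L : R) :
    0 <= K ->
    (forall n, 0 <= rho n) -> (forall n, rho n <= K * delta n) ->
    (forall n, 0 <= F n) -> (forall n, F n <= C * rho n) ->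
    (forall n, F n.+1 = F n - delta n) ->
  exists B, series rho @ \oo --> B /\
    series (fun n => L * rho n - delta n) @ \oo --> L * B - F 0%N.
Proof.
move=> K0 rho0 rho_le F0 F_le FS.
have sum_delta n : series delta n = F 0%N - F n.
  elim: n => [|n IH]; first by rewrite /series/= big_nil subrr.
  by rewrite seriesSr IH FS; ring.
have cvg_rho : cvgn (series rho).
  apply: nondecreasing_is_cvgn.
    by apply/nondecreasing_seqP => n; rewrite seriesSr lerDl.
  exists (K * F 0%N) => _ [n _ <-].
  (* The [delta] telescope to [F 0 - F n], so [K * F 0] bounds every partial sum of [rho]. *)
  apply: (@le_trans _ _ (K * series delta n)).
    by rewrite /series/= mulr_sumr ler_sum.
  by rewrite ler_wpM2l// sum_delta gerBl.
have cvg_F : F @ \oo --> (0 : R).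
  apply: (@squeeze_cvgr _ _ _ _ (cst 0) (fun n => C * rho n)).
  - by apply: nearW => n; rewrite F0 F_le.
  - exact: cvg_cst.
  - rewrite -(mulr0 C); apply: cvgMr; exact: cvg_series_cvg_0.
exists (limn (series rho)); split=> //.
rewrite [X in X @ _](_ : _ = fun n => L * series rho n - F 0%N + F n); last first.
  apply/funext => n; rewrite -addrA [- _ + _]addrC -opprB -sum_delta.
  by rewrite /series/= sumrB -mulr_sumr.
rewrite -[L * _ - _]addr0; apply: cvgD => //.
by apply: cvgB; [exact: cvgMr|exact: cvg_cst].
Qed.

Lemma nneseries_EFin (R : realType) (u : R^nat) (l : R) :
  series u @ \oo --> l -> (\sum_(0 <= n <oo) (u n)%:E = l%:E)%E.
Proof.
move=> ul; apply/cvg_lim => //.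
by under eq_fun do rewrite sumEFin; apply: cvg_EFin; [exact: nearW|exact: ul].
Qed.

End RealSeries.

Local Arguments play : simpl never.

(** * The random game: stopping, laws of histories, expectations *)

Section Game.
Variables (R : realType) (P M L : nat) (q : {set 'I_M} -> R).
Variables (d : measure_display) (T : measurableType d) (Pr : probability T R).
Variable X : nat -> T -> burst P M.
Implicit Types (S : collections P M) (b : burst P M) (w : T).

Lemma playS w n : play X w n.+1 = rcons (play X w n) (X n w).
Proof. exact: mkseqS. Qed.

Lemma collections_playS w n :
  collections_after (play X w n.+1) =
  after_burst (collections_after (play X w n)) (X n w).
Proof. by rewrite playS /collections_after foldl_rcons. Qed.

Lemma goal_afterW w m n : (m <= n)%N -> goal_after X w m -> goal_after X w n.
Proof.
move=> /subnK <-; elim: (n - m)%N => // k IH /IH.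
by rewrite addSn /goal_after collections_playS; exact: common_goal_after_burst.
Qed.

(** The goal persists once reached, so the series counts the [n] before the first success; without
    success both sides are [+oo]. This form can be integrated term by term. *)
Lemma goal_time_series w :
  goal_time R X w = (\sum_(0 <= n <oo) (~~ goal_after X w n)%:R%:E)%E.
Proof.
rewrite /goal_time.
have nd0 n : (0 <= (~~ goal_after X w n)%:R%:E :> \bar R)%E by rewrite lee_fin.
have [gw|ngw] := pselect (exists n, goal_after X w n).
  case: (ex_minnP gw) => m gm m_min.
  rewrite (nneseries_split 0 m)// add0n [X in (_ + X)%E]eseries0 ?adde0; last first.
    by move=> n mn _; rewrite (goal_afterW mn gm).
  rewrite (eq_big_nat _ _ (F2 := fun=> 1%:E)) => [|n /andP[_ nm]]; last first.
    by case: (boolP (goal_after X w n)) => // /m_min; rewrite leqNgt nm.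
  rewrite sumEFin sumr_const_nat subn0; apply/eqP; rewrite eq_le; apply/andP; split.
    by apply: ereal_inf_lbound; exists m.
  by apply: le_ereal_inf_tmp => _ [n /= /m_min mn <-]; rewrite lee_fin ler_nat.
rewrite (_ : [set n | goal_after X w n]%classic = set0); last first.
  by apply/seteqP; split=> // n /= gn; case: ngw; exists n.
rewrite image_set0 ereal_inf0; apply/esym/eq_infty => r.
(* With all terms equal to 1, the first [(Num.truncn r).+1] of them already exceed [r]. *)
apply: (@le_trans _ _
  (\sum_(0 <= n < (Num.truncn r).+1) (~~ goal_after X w n)%:R%:E)%E).
  rewrite (eq_bigr (fun=> 1%:E)) => [|n _]; last first.
    by case: (boolP (goal_after X w n)) => // gn; case: ngw; exists n.
  by rewrite sumEFin sumr_const_nat subn0 lee_fin ltW// truncnS_gt.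
exact: nneseries_lim_ge.
Qed.

Hypothesis hX : coupon_game Pr X q.

(** Tuples of fixed length form a finite type, unlike sequences, so the results on finitely valued
    variables apply to histories. *)
Definition play_tuple n w : n.-tuple (burst P M) :=
  map_tuple (X^~ w) (iota_tuple n 0).

Lemma measurable_play n (s : seq (burst P M)) :
  measurable [set w | play X w n = s]%classic.
Proof.
have [mX _] := hX.
elim: n s => [|n IH] s.
  rewrite [X in measurable X](_ : _ = if s is [::] then setT else set0).
    by case: s => [|? ?]; [exact: measurableT|exact: measurable0].
  by apply/seteqP; case: s => [|? ?]; split=> w.
case/lastP: s => [|s c].
  by rewrite [X in measurable X](_ : _ = set0)//; apply/seteqP; split.
rewrite [X in measurable X](_ : _ =
    [set w | play X w n = s]%classic `&` [set w | X n w = c]%classic)%classic.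
  exact: measurableI.
apply/seteqP; split=> w /=; rewrite playS.
  by move=> /rcons_inj[].
by move=> [-> ->].
Qed.

Lemma play_tupleE n (h : n.-tuple (burst P M)) :
  [set w | play_tuple n w = h]%classic = [set w | play X w n = h]%classic.
Proof.
apply/seteqP; split=> w /= [e]; first by rewrite -e.
exact: val_inj.
Qed.

Lemma measurable_play_tuple n (h : n.-tuple (burst P M)) :
  measurable [set w | play_tuple n w = h]%classic.
Proof. by rewrite play_tupleE; exact: measurable_play. Qed.

Lemma play_tuple_burstE n (h : n.-tuple (burst P M)) b :
  [set w | (play_tuple n w, X n w) = (h, b)]%classic =
  [set w | play X w n.+1 = rcons h b]%classic.
Proof.
apply/seteqP; split=> w /=; rewrite playS; first by move=> [<- <-].
by move=> /rcons_inj[e <-]; congr (_, _); exact: val_inj.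
Qed.

Lemma measurable_play_tuple_burst n (u : n.-tuple (burst P M) * burst P M) :
  measurable [set w | (play_tuple n w, X n w) = u]%classic.
Proof.
by case: u => h b; rewrite play_tuple_burstE; exact: measurable_play.
Qed.

Lemma law_play_tuple_burst n (h : n.-tuple (burst P M)) b :
  ~~ common_goal (collections_after h) ->
  law Pr (fun w => (play_tuple n w, X n w)) (h, b) =
  law Pr (play_tuple n) h * burst_prob q (collections_after h) b.
Proof.
move=> ngh; have [_ /(_ h b ngh)] := hX; rewrite size_tuple => Prh.
apply: EFin_inj; rewrite EFinM !EFin_law; last exact: measurable_play_tuple_burst.
  by rewrite play_tuple_burstE Prh play_tupleE.
exact: measurable_play_tuple.
Qed.

(** Being a finite real sum, it is linear and monotone without any integrability argument;
    [integral_play] identifies it with an integral. *)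
Definition expect n (F : collections P M -> R) : R :=
  \sum_(h : n.-tuple (burst P M))
     law Pr (play_tuple n) h * F (collections_after h).

Lemma expect_le n F G : (forall S, F S <= G S) -> expect n F <= expect n G.
Proof.
by move=> FG; apply: ler_sum => h _; rewrite ler_wpM2l// law_ge0.
Qed.

Lemma expect_ge0 n F : (forall S, 0 <= F S) -> 0 <= expect n F.
Proof.
by move=> F0; apply: sumr_ge0 => h _; rewrite mulr_ge0// law_ge0.
Qed.

Lemma expectB n F G : expect n F - expect n G = expect n (fun S => F S - G S).
Proof. by rewrite -sumrB; apply: eq_bigr => h _; rewrite mulrBr. Qed.

Lemma expectZ n c F : c * expect n F = expect n (fun S => c * F S).
Proof. by rewrite mulr_sumr; apply: eq_bigr => h _; rewrite mulrCA. Qed.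

Lemma eq_expect n F G : F =1 G -> expect n F = expect n G.
Proof. by move=> FG; apply: eq_bigr => h _; rewrite FG. Qed.

Lemma expect0 F : expect 0 F = F (empty_collections P M).
Proof.
rewrite /expect (big_pred1 [tuple]) => [|h]; last exact/esym/eqP/tuple0.
rewrite /law play_tupleE (_ : [set w | _]%classic = setT).
  by rewrite probability_setT mul1r.
by apply/seteqP.
Qed.

Lemma integral_play n (F : collections P M -> R) : (forall S, 0 <= F S) ->
  (\int[Pr]_w (F (collections_after (play X w n)))%:E = (expect n F)%:E)%E.
Proof.
move=> F0.
exact: (integral_fin_valued Pr (@measurable_play_tuple n)
         (F := fun h => F (collections_after h))).
Qed.

(** The cut at the goal matters because the law of the next burst is prescribed only before it.
    [running (fun=> 1)] is the indicator of a running game. *)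
Definition running F S : R := if common_goal S then 0 else F S.

Lemma running_ge0 F S : (forall S, 0 <= F S) -> 0 <= running F S.
Proof. by rewrite /running; case: ifP. Qed.

Lemma measurable_running_burst n (G : collections P M -> burst P M -> R) :
  measurable_fun setT (fun w =>
    (running (G^~ (X n w)) (collections_after (play X w n)))%:E).
Proof.
move=> _ Y _; rewrite setTI.
exact: (measurable_preimage_fin (@measurable_play_tuple_burst n)
  (fun u => Y (running (G^~ u.2) (collections_after u.1))%:E)).
Qed.

(** This is conditioning on the history: given an unfinished one, the next burst has law
    [burst_prob]; a finished one contributes 0 to both sides. *)
Lemma integral_running_burst n (G : collections P M -> burst P M -> R) :
  (forall S b, 0 <= G S b) ->
  (\int[Pr]_w (running (G^~ (X n w)) (collections_after (play X w n)))%:E =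
   (expect n (running (fun S => \sum_b burst_prob q S b * G S b)))%:E)%E.
Proof.
move=> G0.
rewrite (integral_fin_valued Pr (@measurable_play_tuple_burst n)
  (F := fun u => running (G^~ u.2) (collections_after u.1))) => [|u]; last first.
  exact: running_ge0.
pose f (h : n.-tuple (burst P M)) b :=
  law Pr (fun w => (play_tuple n w, X n w)) (h, b) *
  running (G^~ b) (collections_after h).
rewrite (eq_bigr (fun u => f u.1 u.2)) => [|[]//].
rewrite -(pair_bigA _ f) /f/=; congr (_%:E).
apply: eq_bigr => h _; rewrite /running; case: ifPn => [_|ngh].
  by rewrite mulr0 big1// => b _; rewrite mulr0.
by rewrite mulr_sumr; apply: eq_bigr => b _; rewrite law_play_tuple_burst// mulrA.
Qed.

Hypothesis P_gt0 : (0 < P)%N.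
Hypothesis hq : lot_distribution L q.

Lemma expect_potentialS n :
  expect n.+1 (@potential R P M) =
  expect n (@potential R P M) - expect n (running (drift q)).
Proof.
apply: EFin_inj; rewrite -integral_play; last exact: potential_ge0.
(* Past the goal the potential stays 0 whatever [X n] is, so cutting there changes nothing. *)
transitivity (\int[Pr]_w (running (fun S => potential R (after_burst S (X n w)))
    (collections_after (play X w n)))%:E)%E.
  apply: eq_integral => w _; rewrite collections_playS /running.
  case: ifPn => // g; congr (_%:E).
  exact/potential_goal/common_goal_after_burst.
rewrite (integral_running_burst _ (G := fun S b => potential R (after_burst S b)));
  last by move=> *; exact: potential_ge0.
congr (_%:E); rewrite expectB; apply: eq_expect => S.
rewrite /running; case: ifPn => [g|_]; first by rewrite potential_goal ?subrr.
exact: (expected_potential P_gt0 hq).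
Qed.

(** Nonnegative terms let the integral pass inside the series for [goal_time]. *)
Lemma Bgoal_series B :
  (series (fun n => expect n (running (fun=> 1))) @ \oo --> B)%classic ->
  Bgoal Pr X = B%:E.
Proof.
move=> cvgB; rewrite -(nneseries_EFin cvgB) /Bgoal.
have Erun n w : (~~ goal_after X w n)%:R =
    running (fun=> 1) (collections_after (play X w n)).
  by rewrite /running /goal_after; case: ifP.
under eq_integral do (rewrite goal_time_series; under eq_eseriesr do rewrite Erun).
rewrite integral_nneseries//; last by move=> n w _; rewrite lee_fin running_ge0.
  by apply: eq_eseriesr => n _; rewrite integral_play// => S; exact: running_ge0.
by move=> n; exact: (measurable_running_burst n (fun _ _ => 1)).
Qed.

(** The same exchange applies to the offers; while the game runs, the conditional mean of burst [n]
    is [L] minus the drift by [expected_offered]. *)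
Lemma Coff_series C :
  (series (fun n => L%:R * expect n (running (fun=> 1)) -
     expect n (running (drift q))) @ \oo --> C)%classic ->
  Coff Pr X = C%:E.
Proof.
move=> cvgC; rewrite -(nneseries_EFin cvgC) /Coff /num_offered.
pose G S b : R := #|offered S b|%:R.
transitivity (\int[Pr]_w (\sum_(0 <= n <oo)
    (running (G^~ (X n w)) (collections_after (play X w n)))%:E))%E.
  apply: eq_integral => w _; rewrite eseries_mkcond; apply: eq_eseriesr => n _.
  by rewrite /running /goal_after; case: common_goal.
rewrite integral_nneseries//; first last.
- by move=> n w _; rewrite lee_fin running_ge0.
- by move=> n; exact: measurable_running_burst.
apply: eq_eseriesr => n _; rewrite integral_running_burst//; congr (_%:E).
rewrite expectZ expectB; apply: eq_expect => S; rewrite /running.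
case: ifP => _; first by rewrite mulr0 subrr.
by rewrite mulr1; exact: (expected_offered P_gt0 hq).
Qed.

End Game.

(** Finiteness of [Bgoal] is included so that the identity is one between real numbers and not
    between infinities. *)
Theorem theorem4 (R : realType) (P M L : nat)
    (hP : (1 <= P)%N) (hM : (1 <= M)%N) (hL : (1 <= L <= M)%N)
    (q : {set 'I_M} -> R) (hq : lot_distribution L q)
    (d : measure_display) (T : measurableType d) (Pr : probability T R)
    (X : nat -> T -> burst P M) (hX : coupon_game Pr X q) :
  Bgoal Pr X \is a fin_num /\
  Coff Pr X = (Bgoal Pr X * L%:R%:E - (M%:R / 2 * (P%:R + 1))%:E)%E.
Proof.
have [K K0 driftK] := drift_bound hP hq.
(* There are finitely many states, so the sum of all potentials is a crude uniform bound. *)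
pose C := \sum_(S : collections P M) potential R S.
have potC (S : collections P M) : potential R S <= C.
  by rewrite /C (bigD1 S)//= lerDl sumr_ge0// => *; exact: potential_ge0.
have [B [cvgB cvgC]] : exists B : R,
    (series (fun n => expect Pr X n (running (fun=> 1))) @ \oo --> B)%classic /\
    (series (fun n => L%:R * expect Pr X n (running (fun=> 1))
       - expect Pr X n (running (drift q))) @ \oo -->
     L%:R * B - expect Pr X 0 (@potential R P M))%classic.
  apply: (@drift_series _ _ _ (fun n => expect Pr X n (@potential R P M)) K C) => // n.
  - by apply: expect_ge0 => S; exact: running_ge0.
  - rewrite expectZ; apply: expect_le => S; rewrite /running.
    by case: ifPn => [_|/driftK//]; rewrite mulr0.
  - by apply: expect_ge0 => S; exact: potential_ge0.
  - rewrite expectZ; apply: expect_le => S; rewrite /running.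
    by case: ifPn => [g|_]; rewrite ?mulr0 ?mulr1// potential_goal.
  - exact: expect_potentialS hX hP hq n.
rewrite (Bgoal_series hX cvgB); split=> //.
rewrite -EFinM -EFinB mulrC -(potential_empty _ _ hP) -(expect0 Pr X).
exact: (Coff_series hX hP hq).
Qed.
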